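(* Let $G_5=C_5\times C_5$ be the elementary abelian group of order $25$, and let $S(G_5)\subseteq\mathbb{Z}$ be the set of all values of its group determinant at integer arguments. Then \[ S(G_5)\cap 5\mathbb{Z}=5^8\mathbb{Z}. \]
   Context: For a finite group $G$, the group determinant is $\Theta_G((x_g)_{g\in G})=\det(x_{gh^{-1}})_{g,h\in G}$, and $S(G):=\{\Theta_G((a_g)_{g\in G}) : a_g\in\mathbb{Z}\}\subseteq\mathbb{Z}$. $C_n$ denotes the cyclic group of order $n$. For $n,k\ge 1$, $n^k\mathbb{Z}$ denotes the set of integer multiples of $n^k$. *)

(* Defs.v *)
From mathcomp Require Import all_boot all_order all_fingroup all_algebra.
From mathcomp Require Import classical_sets.

Set Implicit Arguments.
Unset Strict Implicit.
Unset Printing Implicit Defensive.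

Import GRing.Theory.
Local Open Scope ring_scope.
Local Open Scope classical_set_scope.

(* Rows and columns are both listed in the order of [enum gT]; since the same
   enumeration is used on both sides, the determinant does not depend on it. *)
Definition group_mx (R : comNzRingType) (gT : finGroupType) (x : gT -> R) :
    'M[R]_#|gT| :=
  \matrix_(i, j) x (enum_val i * (enum_val j)^-1)%g.

Definition group_det (R : comNzRingType) (gT : finGroupType) (x : gT -> R) : R :=
  \det (group_mx x).

Definition group_det_values (gT : finGroupType) : set int :=
  [set group_det a | a in [set: gT -> int]].

Definition multiples (d : int) : set int := [set m | (d %| m)%Z].

(* The group law of ['Z_5] is addition modulo 5, and the law on the product
   type is componentwise. *)
Definition C5xC5 : finGroupType := ('Z_5 * 'Z_5)%type.

(* Main.v *)
Require Import Defs.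
From mathcomp Require Import all_boot all_order all_fingroup all_algebra.
From mathcomp Require Import all_field ring.
From mathcomp Require Import classical_sets.

Set Implicit Arguments.
Unset Strict Implicit.
Unset Printing Implicit Defensive.

Import GRing.Theory Num.Theory.
Local Open Scope ring_scope.
Local Open Scope classical_set_scope.

(* By the DFT, Theta(a) is the product of the 25 character sums of a. The trivial
   one is S = sum of a; the others fall into six Galois orbits, one for each line
   through 0 in the plane F_5^2, contributing the norms N_1, ..., N_6 of elements
   of Z[zeta_5] (the images of a in Z[C_5] under six quotient maps). Modulo the
   prime above 5 all characters agree, so 5 | Theta(a) forces 5 to divide S and
   every N_i, i.e. 5^7 | Theta(a). The first-order term of the i-th character sum
   at that prime is a linear form on F_5^2 evaluated on the i-th line, so it
   vanishes for some i, where N_i is divisible by 25.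
   Conversely, adding a constant k to a changes S by 25 k and fixes all N_i, so it
   suffices to find a with N_1...N_6 = 5^7 and S = 5 r for r in {0, 1, 2, -1, -2}. *)

(** * Factorization of a group determinant by characters *)

Lemma group_det_prod_char (R : idomainType) (gT : finGroupType)
    (chi : gT -> gT -> R) (x : gT -> R) :
    #|gT|%:R != 0 :> R -> (forall c, chi c 1%g = 1) ->
    (forall c, {morph chi c : g h / (g * h)%g >-> g * h}) ->
    (forall g, g != 1%g -> \sum_c chi c g = 0) ->
  group_det x = \prod_c \sum_g chi c g * x g.
Proof.
move=> nz_card chi1 chiM chi_orth.
pose n := #|gT|.
pose F : 'M[R]_n := \matrix_(i, j) chi (enum_val i) (enum_val j).
pose F' : 'M[R]_n := \matrix_(i, j) chi (enum_val j) (enum_val i)^-1%g.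
pose d : 'rV[R]_n := \row_i \sum_g chi (enum_val i) g * x g.
(* Orthogonality makes [F'] inverse to the character table [F] up to the factor [#|gT|], so [\det F]
   is nonzero and can be cancelled at the end. *)
have F'F : F' *m F = n%:R%:M.
  apply/matrixP => i j; rewrite !mxE.
  under eq_bigr => k _ do rewrite !mxE -chiM.
  rewrite -(big_enum_val (A := gT) (fun c => chi c ((enum_val i)^-1 * enum_val j)%g)).
  have [<-|ne_ij] := eqVneq i j.
    rewrite mulVg; under eq_bigr do rewrite chi1.
    by rewrite sumr_const mulr1n.
  rewrite chi_orth // -eq_mulVg1; apply: contra ne_ij => /eqP/enum_val_inj ->.
  exact: eqxx.
have nzF : \det F != 0.
  have : \det (F' *m F) != 0 by rewrite F'F det_scalar expf_neq0.
  by rewrite det_mulmx mulf_eq0 negb_or => /andP[].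
(* Each row of [F] is a left eigenvector of the group matrix. *)
have FM : F *m group_mx x = diag_mx d *m F.
  apply/matrixP => i j; rewrite mul_diag_mx !mxE.
  under eq_bigr => k _ do rewrite !mxE.
  rewrite -(big_enum_val (A := gT)
    (fun g => chi (enum_val i) g * x (g * (enum_val j)^-1)%g)).
  rewrite (reindex_inj (mulIg (enum_val j))) /= mulr_suml.
  by apply: eq_bigr => g _; rewrite chiM mulgK mulrAC.
have := congr1 determinant FM; rewrite !det_mulmx det_diag mulrC => /(mulIf nzF).
rewrite /group_det => ->.
rewrite (big_enum_val (A := gT) (fun c => \sum_g chi c g * x g)).
by apply: eq_bigr => i _; rewrite mxE.
Qed.

Lemma big_Z5 (R : Type) (idx : R) (op : Monoid.law idx) (F : 'Z_5 -> R) :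
  \big[op/idx]_i F i = op (F 0) (op (F 1) (op (F 2) (op (F 3) (F 4)))).
Proof.
rewrite !big_ord_recl big_ord0 Monoid.mulm1.
by do ![congr (op _ _)]; congr F; apply: val_inj.
Qed.

(* The norm from Q(zeta) to Q of [\sum_i c i * zeta ^ i], for zeta a primitive
   fifth root of unity. *)
Definition norm5 (R : comNzRingType) (c : 'Z_5 -> R) : R :=
  let s0 := c 0 ^+ 2 + c 1 ^+ 2 + c 2 ^+ 2 + c 3 ^+ 2 + c 4 ^+ 2 in
  let s1 := c 0 * c 1 + c 1 * c 2 + c 2 * c 3 + c 3 * c 4 + c 4 * c 0 in
  let s2 := c 0 * c 2 + c 1 * c 3 + c 2 * c 4 + c 3 * c 0 + c 4 * c 1 in
  s0 ^+ 2 - s1 ^+ 2 - s2 ^+ 2 - s0 * s1 - s0 * s2 + 3 * (s1 * s2).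

Lemma prod_conj_norm5 (R : comNzRingType) (z : R) (c : 'Z_5 -> R) :
    z ^+ 4 = - (1 + z + z ^+ 2 + z ^+ 3) ->
  \prod_(m <- [:: 1; 2; 3; 4] : seq 'Z_5) (\sum_i z ^+ (m * i : 'Z_5)%R * c i)
    = norm5 c.
Proof.
move=> Hz; rewrite !big_cons big_nil !big_Z5 /norm5 /=.
by ring: Hz.
Qed.

Lemma norm5_eq (R : comNzRingType) (c c' : 'Z_5 -> R) : c =1 c' -> norm5 c = norm5 c'.
Proof. by move=> e; rewrite /norm5 !e. Qed.

Lemma norm5_map (R S : comNzRingType) (f : {rmorphism R -> S}) (c : 'Z_5 -> R) :
  norm5 (f \o c) = f (norm5 c).
Proof. by rewrite /norm5 /= !(rmorphD, rmorphN, rmorphM, rmorphXn, rmorph_nat). Qed.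

Lemma norm5N (R : comNzRingType) (c : 'Z_5 -> R) : norm5 (fun i => - c i) = norm5 c.
Proof. by rewrite /norm5 /=; ring. Qed.

(** A constant sequence represents a multiple of [1 + zeta + ... + zeta ^ 4 = 0]. *)
Lemma norm5_shift (R : comNzRingType) (c : 'Z_5 -> R) (k : R) :
  norm5 (fun i => c i + k) = norm5 c.
Proof. by rewrite /norm5 /=; ring. Qed.

(** * Characters of the plane, grouped by lines *)

Definition dot5 (v g : 'Z_5 * 'Z_5) : 'Z_5 := v.1 * g.1 + v.2 * g.2.

Definition pushforward (R : nmodType) (a : C5xC5 -> R) (v : 'Z_5 * 'Z_5)
    (i : 'Z_5) : R :=
  \sum_(g | dot5 v g == i) a g.

Lemma dot5Z (m : 'Z_5) (v g : 'Z_5 * 'Z_5) :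
  dot5 (m * v.1, m * v.2) g = m * dot5 v g.
Proof. by rewrite /dot5 /= mulrDr !mulrA. Qed.

(* One vector on each of the six lines through the origin of the plane over F_5. *)
Definition lines : seq ('Z_5 * 'Z_5) :=
  [:: (0, 1); (1, 0); (1, 1); (1, 2); (1, 3); (1, 4)].

Definition lines_norm (R : comNzRingType) (a : C5xC5 -> R) : R :=
  \prod_(v <- lines) norm5 (pushforward a v).

(** Every nonzero vector is a nonzero multiple of exactly one element of [lines]. For character
    sums, the product over [m] runs over one Galois orbit. *)
Lemma prod_lines (R : comNzRingType) (F : C5xC5 -> R) :
  \prod_c F c = F 0 *
    \prod_(v <- lines) \prod_(m <- [:: 1; 2; 3; 4] : seq 'Z_5) F (m * v.1, m * v.2).
Proof.
pose s := 0 :: [seq (m * v.1, m * v.2) | v <- lines, m <- [:: 1; 2; 3; 4]] : seq C5xC5.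
rewrite (perm_big s); last first.
  apply: uniq_perm; rewrite ?index_enum_uniq // => -[[x ltx] [y lty]].
  rewrite mem_index_enum; apply/esym.
  by case: x ltx => [|[|[|[|[|x]]]]] ltx //; case: y lty => [|[|[|[|[|y]]]]] lty.
by rewrite big_cons big_allpairs_dep.
Qed.

Section PrimitiveRoot.

Variables (R : fieldType) (z : R).
Hypothesis z_prim : 5.-primitive_root z.

Lemma prim5_expD (i j : 'Z_5) : z ^+ (i + j : 'Z_5)%R = z ^+ i * z ^+ j.
Proof. by rewrite -exprD -[RHS](prim_expr_mod z_prim). Qed.

Lemma prim5_sum_expM (x : 'Z_5) : x != 0 -> \sum_i z ^+ (i * x : 'Z_5)%R = 0.
Proof.
move=> nz_x.
(* Multiplication by [z ^+ x], which is not 1, only permutes the terms of the sum. *)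
have nz_zx : z ^+ x - 1 != 0.
  by rewrite subr_eq0 -(prim_order_dvd z_prim); case: x nz_x => [[|[|[|[|[|x]]]]]].
apply: (mulfI nz_zx); rewrite mulr0 mulrBl mul1r mulr_sumr.
under eq_bigr => i _ do rewrite -prim5_expD -{1}[x]mul1r -mulrDl addrC.
rewrite [X in _ - X](reindex_inj (addIr 1)) /=.
by rewrite subrr.
Qed.

Lemma prim5_exp4 : z ^+ 4 = - (1 + z + z ^+ 2 + z ^+ 3).
Proof.
have := prim5_sum_expM (isT : (1 : 'Z_5) != 0); rewrite big_Z5 /= => /eqP.
rewrite -subr_eq0 => /eqP e; apply/eqP; rewrite -subr_eq0 -e; apply/eqP; ring.
Qed.

Lemma group_det_C5xC5_prim (a : C5xC5 -> R) : 5%:R != 0 :> R ->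
  group_det a = (\sum_g a g) * lines_norm a.
Proof.
move=> nz5; pose chi (c g : C5xC5) := z ^+ dot5 c g.
rewrite (@group_det_prod_char R C5xC5 chi); first last.
- move=> [x y] nz_xy; rewrite -(pair_bigA _ (fun s t => chi (s, t) (x, y))) /=.
  have chiE s t : chi (s, t) (x, y) = z ^+ (s * x : 'Z_5)%R * z ^+ (t * y : 'Z_5)%R.
    by rewrite -prim5_expD.
  under eq_bigr do under eq_bigr do rewrite chiE.
  under eq_bigr do rewrite -mulr_sumr.
  rewrite -mulr_suml; have [x0|nz_x] := eqVneq x 0; last first.
    by rewrite prim5_sum_expM ?mul0r.
  rewrite (@prim5_sum_expM y) ?mulr0 //; apply: contra nz_xy => /eqP ->.
  by rewrite x0.
- move=> c g h; rewrite /chi -prim5_expD /dot5; congr (z ^+ _); congr (nat_of_ord _).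
  by rewrite /= !mulrDr addrACA.
- by move=> c; rewrite /chi /dot5 !mulr0.
- by rewrite card_prod card_ord natrM mulf_neq0.
rewrite prod_lines; congr (_ * _).
  by apply: eq_bigr => g _; rewrite /chi /dot5 !mul0r addr0 expr0 mul1r.
apply: eq_bigr => v _; rewrite -(prod_conj_norm5 _ prim5_exp4).
apply: eq_bigr => m _; rewrite (partition_big (dot5 v) predT) //=.
apply: eq_bigr => i _; rewrite mulr_sumr.
by apply: eq_bigr => g /eqP <-; rewrite /chi dot5Z.
Qed.

End PrimitiveRoot.

Lemma group_det_map (R S : comNzRingType) (f : {rmorphism R -> S})
    (gT : finGroupType) (x : gT -> R) :
  group_det (f \o x) = f (group_det x).
Proof.
rewrite /group_det -det_map_mx; congr determinant.
by apply/matrixP => i j; rewrite !mxE.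
Qed.

(** Both sides are integers, so they can be compared in [algC], which has a primitive fifth root of
    unity. *)
Lemma group_det_C5xC5 (a : C5xC5 -> int) :
  group_det a = (\sum_g a g) * lines_norm a.
Proof.
have [z z_prim] := C_prim_root_exists (isT : (0 < 5)%N).
pose f : {rmorphism int -> algC} := intr.
apply: (intr_inj (R := algC)); rewrite -[LHS](group_det_map f).
have nz5 : 5%:R != 0 :> algC by rewrite pnatr_eq0.
rewrite (group_det_C5xC5_prim z_prim _ nz5).
rewrite -[_%:~R]/(f _) /lines_norm rmorphM rmorph_sum rmorph_prod.
congr (_ * _); apply: eq_bigr => v _; rewrite -[RHS](norm5_map f).
rewrite /norm5 /= /pushforward.
by rewrite !rmorph_sum.
Qed.

(** * Divisibility by powers of 5 *)

Lemma dvdz5_intr (x : int) : (5 %| x)%Z = (x%:~R == 0 :> 'Z_5).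
Proof. by rewrite (dvdz_pcharf (pchar_Fp (isT : prime 5))). Qed.

(* Congruence to the fourth power of the sum: zeta is 1 modulo the prime above 5. *)
Lemma norm5_expand (R : comNzRingType) (c : 'Z_5 -> R) :
  let s1 := c 0 * c 1 + c 1 * c 2 + c 2 * c 3 + c 3 * c 4 + c 4 * c 0 in
  let s2 := c 0 * c 2 + c 1 * c 3 + c 2 * c 4 + c 3 * c 0 + c 4 * c 1 in
  norm5 c = (\sum_i c i) ^+ 4 - 5 * (s1 + s2) * (\sum_i c i) ^+ 2
            + 5 * (s1 - s2) ^+ 2 + 25 * (s1 * s2).
Proof. by rewrite /norm5 big_Z5 /=; ring. Qed.

Lemma dvdz5_norm5 (c : 'Z_5 -> int) : (5 %| norm5 c)%Z = (5 %| \sum_i c i)%Z.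
Proof.
rewrite norm5_expand /=; set s := \sum_i c i; set s1 := _ + c 4 * c 0.
set s2 := _ + c 4 * c 1.
have -> : s ^+ 4 - 5 * (s1 + s2) * s ^+ 2 + 5 * (s1 - s2) ^+ 2 + 25 * (s1 * s2)
  = (5 * (s1 * s2) + (s1 - s2) ^+ 2 - (s1 + s2) * s ^+ 2) * 5 + s ^+ 4 by ring.
by rewrite rpredDl; [rewrite !dvdzE abszX Euclid_dvdX ?andbT | apply: dvdz_mull].
Qed.

(** Modulo [(zeta - 1) ^ 2] the element is [sum c_i + (zeta - 1) * sum i c_i]; both terms vanish
    there, and [zeta - 1] has norm 5. *)
Lemma dvdz25_norm5 (c : 'Z_5 -> int) :
    (5 %| \sum_i c i)%Z -> \sum_i (c i)%:~R * i = 0 :> 'Z_5 ->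
  (25 %| norm5 c)%Z.
Proof.
move=> /dvdzP[s def_s] T1_0.
have /dvdzP[t def_t] : (5 %| (c 1 + 2 * c 2 + 3 * c 3 + 4 * c 4)%R)%Z.
  rewrite dvdz5_intr -[X in _ == X]T1_0 big_Z5; apply/eqP.
  rewrite !rmorphD !rmorphM /=; ring.
rewrite norm5_expand /= def_s.
pose t2 := c 1 + 4 * c 2 + 9 * c 3 + 16 * c 4.
(* The coefficient of [c_i c_j] is [((i - j)^2 - e) / 5], with [e] the Legendre symbol of [i - j]
   modulo 5. *)
pose u := c 0 * c 2 + c 1 * c 3 + c 2 * c 4 + 2 * c 0 * c 3 + 2 * c 1 * c 4
  + 3 * c 0 * c 4.
set s1 := _ + c 4 * c 0; set s2 := _ + c 4 * c 1.
(* 2 (s1 - s2) is the sum of ((i - j) / 5) c_i c_j, and the Legendre symbol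
   ((i - j) / 5) is congruent to (i - j)^2, so modulo 5 the difference s1 - s2 is
   (sum c_i) (sum i^2 c_i) - (sum i c_i)^2. *)
have -> : s1 - s2 = 5 * (s * t2 - 5 * t ^+ 2 - u).
  transitivity ((s * 5) * t2 - (t * 5) ^+ 2 - 5 * u); last by ring.
  by rewrite -def_s -def_t big_Z5 /s1 /s2 /t2 /u /=; ring.
set w := _ - u; apply/dvdzP.
exists (25 * s ^+ 4 - 5 * (s1 + s2) * s ^+ 2 + 5 * w ^+ 2 + s1 * s2); ring.
Qed.

Lemma sum_pushforward (R : nmodType) (a : C5xC5 -> R) (v : 'Z_5 * 'Z_5) :
  \sum_i pushforward a v i = \sum_g a g.
Proof. by rewrite [RHS](partition_big (dot5 v) predT). Qed.

Lemma moment_pushforward (a : C5xC5 -> int) (v : 'Z_5 * 'Z_5) :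
  \sum_i (pushforward a v i)%:~R * i = \sum_g (a g)%:~R * dot5 v g :> 'Z_5.
Proof.
rewrite [RHS](partition_big (dot5 v) predT) //=; apply: eq_bigr => i _.
rewrite raddf_sum mulr_suml.
by apply: eq_bigr => g /eqP ->.
Qed.

(** The kernel of a linear form on the plane contains a line. *)
Lemma lines_orthogonal (x y : 'Z_5) : has (fun v => dot5 v (x, y) == 0) lines.
Proof.
case: x => [[|[|[|[|[|x]]]]] ltx] //; case: y => [[|[|[|[|[|y]]]]] lty] //.
Qed.

Lemma dvdz_lines_norm (a : C5xC5 -> int) : (5 %| \sum_g a g)%Z ->
  (5 ^+ 7 %| lines_norm a)%Z.
Proof.
move=> dvd5a.
have dvd5 v : (5 %| norm5 (pushforward a v))%Z.
  by rewrite dvdz5_norm5 sum_pushforward.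
(* [(x, y)] represents the linear form sending [v] to the first moment of [pushforward a v]. *)
pose x : 'Z_5 := \sum_(g : C5xC5) (a g)%:~R * g.1.
pose y : 'Z_5 := \sum_(g : C5xC5) (a g)%:~R * g.2.
have /hasP[v v_line /eqP v_xy] := lines_orthogonal x y.
have dvd25 : (25 %| norm5 (pushforward a v))%Z.
  apply: dvdz25_norm5; first by rewrite sum_pushforward.
  rewrite moment_pushforward -[RHS]v_xy /dot5 /= !mulr_sumr -big_split /=.
  by apply: eq_bigr => g _; rewrite mulrDr !mulrA ![(a g)%:~R * _]mulrC.
rewrite /lines_norm (perm_big _ (perm_to_rem v_line)) big_cons.
(* The line of [v] contributes 25, the five others 5 each. *)
rewrite (_ : 5 ^+ 7 = 25 * 5 ^+ size (rem v lines)).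
  rewrite dvdz_mul //; elim: (rem v lines) => [|w r IHr]; first by rewrite dvd1z.
  by rewrite big_cons exprS dvdz_mul.
by rewrite size_rem.
Qed.

Lemma dvdz_group_det_C5xC5 (a : C5xC5 -> int) :
  (5 %| group_det a)%Z -> (5 ^+ 8 %| group_det a)%Z.
Proof.
rewrite group_det_C5xC5 dvdzE abszM Euclid_dvdM // -!dvdzE => dvd5.
have dvd5a : (5 %| \sum_g a g)%Z.
  case/orP: dvd5 => //; rewrite /lines_norm; elim: lines => [|v r IHr].
    by rewrite big_nil.
  rewrite big_cons dvdzE abszM Euclid_dvdM // -!dvdzE dvdz5_norm5 sum_pushforward.
  by case/orP.
by rewrite exprS dvdz_mul ?dvdz_lines_norm.
Qed.

(** * Realizing every multiple of [5 ^+ 8] *)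

Lemma pushforwardE (R : nmodType) (a : C5xC5 -> R) (v : 'Z_5 * 'Z_5) (i : 'Z_5) :
  pushforward a v i =
    \sum_(x : 'Z_5) \sum_(y : 'Z_5 | v.1 * x + v.2 * y == i) a (x, y).
Proof.
rewrite (pair_big_dep predT (fun x y => v.1 * x + v.2 * y == i) (fun x y => a (x, y))).
by apply: eq_big => -[].
Qed.

Lemma pushforward1 (R : nmodType) (a : C5xC5 -> R) (t i : 'Z_5) :
  pushforward a (1, t) i = \sum_y a (i - t * y, y).
Proof.
rewrite pushforwardE (exchange_big_dep predT) //=; apply: eq_bigr => y _.
by apply: big_pred1 => x /=; rewrite mul1r eq_sym -subr_eq eq_sym.
Qed.

Lemma pushforward01 (R : nmodType) (a : C5xC5 -> R) (i : 'Z_5) :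
  pushforward a (0, 1) i = \sum_x a (x, i).
Proof.
rewrite pushforwardE; apply: eq_bigr => x _.
by apply: big_pred1 => y /=; rewrite mul1r mul0r add0r.
Qed.

(** The factors of [lines_norm] in the order of [lines], with the sums written out so that
    [vm_compute] can evaluate them. *)
Definition line_norms (R : comNzRingType) (a : C5xC5 -> R) : seq R :=
  norm5 (fun i => a (0, i) + (a (1, i) + (a (2, i) + (a (3, i) + a (4, i)))))
  :: [seq norm5 (fun i => a (i, 0) + (a (i - t, 1) + (a (i - t * 2, 2)
                            + (a (i - t * 3, 3) + a (i - t * 4, 4)))))
     | t <- [:: 0; 1; 2; 3; 4]].

Lemma lines_normE (R : comNzRingType) (a : C5xC5 -> R) :
  lines_norm a = \prod_(n <- line_norms a) n.
Proof.
have sum_y t i : pushforward a (1, t) i = a (i, 0) + (a (i - t, 1)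
    + (a (i - t * 2, 2) + (a (i - t * 3, 3) + a (i - t * 4, 4)))).
  by rewrite pushforward1 big_Z5 mulr0 subr0 mulr1.
rewrite /lines_norm /line_norms /lines !big_cons !big_nil; congr (_ * _).
  by apply: norm5_eq => i; rewrite pushforward01 big_Z5.
by rewrite !(norm5_eq (sum_y _)).
Qed.

Lemma lines_normN (R : comNzRingType) (a : C5xC5 -> R) :
  lines_norm (fun g => - a g) = lines_norm a.
Proof.
rewrite /lines_norm; apply: eq_bigr => v _; rewrite -[RHS]norm5N.
by apply: norm5_eq => i; rewrite /pushforward sumrN.
Qed.

Lemma lines_norm_shift (R : comNzRingType) (a : C5xC5 -> R) (k : R) :
  lines_norm (fun g => a g + k) = lines_norm a.
Proof.
rewrite !lines_normE; congr (\prod_(n <- _) n).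
(* Each fibre has five points, so each pushforward is shifted by [5 * k]. *)
do ![congr cons]; rewrite -[RHS](norm5_shift _ (5 * k)).
all: by apply: norm5_eq => i; ring.
Qed.

Lemma sum_C5xC5 (R : nmodType) (a : C5xC5 -> R) :
  \sum_g a g = \sum_(i : 'Z_5) \sum_(j : 'Z_5) a (i, j).
Proof. by rewrite (pair_bigA _ (fun i j => a (i, j))) /=; apply: eq_bigr => -[]. Qed.

Lemma group_det_C5xC5_shift (a : C5xC5 -> int) (k : int) :
  group_det (fun g => a g + k) = (\sum_g a g + 25 * k) * lines_norm a.
Proof.
rewrite group_det_C5xC5 lines_norm_shift big_split /=.
by rewrite sumr_const card_prod card_ord mulr_natl.
Qed.

Definition set_ind (s : seq ('Z_5 * 'Z_5)) (g : C5xC5) : int := (g \in s)%:R.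

(* The witnesses were found by a random computer search. *)
Definition witness0 (g : C5xC5) : int :=
  set_ind [:: (0, 4); (1, 0)] g - set_ind [:: (1, 2); (1, 3)] g.

Definition witness1 : C5xC5 -> int :=
  set_ind [:: (0, 1); (1, 2); (1, 4); (3, 3); (4, 4)].

Definition witness2 : C5xC5 -> int :=
  set_ind [:: (0, 0); (0, 2); (1, 3); (2, 0); (2, 2);
              (3, 0); (3, 3); (4, 0); (4, 2); (4, 3)].

Lemma lines_norm_witness :
  [/\ lines_norm witness0 = 5 ^+ 7, lines_norm witness1 = 5 ^+ 7
    & lines_norm witness2 = 5 ^+ 7].
Proof.
have n0 : line_norms witness0 = [:: 5; 5; 5; 5; 5; 25] by vm_compute.
have n1 : line_norms witness1 = [:: 5; 5; 5; 5; 5; 25] by vm_compute.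
have n2 : line_norms witness2 = [:: 25; 5; 5; 5; 5; 5] by vm_compute.
by split; rewrite lines_normE (n0, n1, n2) !big_cons big_nil; ring.
Qed.

Lemma sum_witness :
  [/\ \sum_g witness0 g = 5 * 0, \sum_g witness1 g = 5 * 1
    & \sum_g witness2 g = 5 * 2].
Proof. by split; rewrite sum_C5xC5 !big_Z5; vm_compute. Qed.

Lemma group_det_C5xC5_mul (q : int) : exists a, @group_det int C5xC5 a = q * 5 ^+ 8.
Proof.
suff [w [r [k [norm_w sum_w ->]]]] : exists w r k,
    [/\ lines_norm w = 5 ^+ 7, \sum_g w g = 5 * r & q = k * 5 + r].
  by exists (fun g => w g + k); rewrite group_det_C5xC5_shift norm_w sum_w; ring.
have [n0 n1 n2] := lines_norm_witness; have [s0 s1 s2] := sum_witness.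
have negP (w : C5xC5 -> int) r : lines_norm w = 5 ^+ 7 -> \sum_g w g = 5 * r ->
    lines_norm (fun g => - w g) = 5 ^+ 7 /\ \sum_g - w g = 5 * - r.
  by move=> nw sw; rewrite (lines_normN w) sumrN sw mulrN.
have [n1' s1'] := negP _ _ n1 s1; have [n2' s2'] := negP _ _ n2 s2.
have := divz_eq q 5; have := ltz_pmod q (isT : 0 < 5 :> int).
have := modz_ge0 q (isT : 5 != 0 :> int).
case: (q %% 5)%Z => // -[|[|[|[|[|r]]]]] // _ _; set k := (q %/ 5)%Z => def_q.
- by exists witness0, 0, k.
- by exists witness1, 1, k.
- by exists witness2, 2, k.
(* Remainders 3 and 4 are replaced by -2 and -1, which raises the quotient by one. *)
- by exists (fun g => - witness2 g), (- 2), (k + 1); split=> //; rewrite def_q; ring.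
- by exists (fun g => - witness1 g), (- 1), (k + 1); split=> //; rewrite def_q; ring.
Qed.

Theorem theorem1p1 :
  group_det_values C5xC5 `&` multiples 5 = multiples (5 ^+ 8).
Proof.
apply/seteqP; split => [m [[a _ <-]] | m /dvdzP[q ->]].
  exact: dvdz_group_det_C5xC5.
split; last by apply: dvdz_mull; rewrite exprS dvdz_mulr.
by have [a <-] := group_det_C5xC5_mul q; exists a.
Qed.
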